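(* Let $g\ge 0$, $l\ge 1$ be integers with $2g-2+l>0$, and let $$LH_g(y_1,\dots,y_l)=\int_{\mathbb{R}^l_{>0}}e^{-y\cdot x}\,H_g(x_1,\dots,x_l)\,dx_1\cdots dx_l,\qquad y_1,\dots,y_l>0,$$ be the Laplace transform of the function $H_g$. Then, with $s_i=\sqrt{2y_i}$, $$LH_g(y_1,\dots,y_l)=\sum_{\substack{k_1,\dots,k_l\ge 0\\ k_1+\cdots+k_l=3g-3+l}}\langle\tau_{k_1}\cdots\tau_{k_l}\rangle_g\prod_{i=1}^l\frac{(2k_i-1)!!}{s_i^{2k_i+1}}.$$
   Context: $\langle\tau_{k_1}\cdots\tau_{k_l}\rangle_g=\int_{\overline{M}_{g,l}}\psi_1^{k_1}\cdots\psi_l^{k_l}$, where $\psi_i$ is the first Chern class of the $i$-th cotangent line bundle on the moduli stack $\overline{M}_{g,l}$ of stable $l$-pointed genus $g$ curves. Convention: $(-1)!!=1$. Hurwitz numbers: for a partition $\mu$ with $l$ positive parts and $|\mu|=\sum\mu_i$, let $r(g,\mu)=2g-2+|\mu|+l$. $H_{g,\mu}$ is the number of isomorphism classes of degree $|\mu|$ covers $\pi:C\to\mathbf{P}^1$, with $C$ a nonsingular irreducible curve of genus $g$, with ramification profile $\mu$ over $\infty$ and simple ramification over each point of a fixed set of $r(g,\mu)$ distinct points of $\mathbf{A}^1=\mathbf{P}^1\setminus\{\infty\}$ (and no other ramification), each cover weighted by $1/|\mathrm{Aut}(\pi)|$. The function $H_g$: for a vector $\mu=(\mu_1,\dots,\mu_l)$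 of distinct positive rational numbers, $$H_g(\mu_1,\dots,\mu_l)=\lim_{N\to\infty}\frac{1}{N^{3g-3+l/2}}\,\frac{H_{g,N\mu}}{e^{N|\mu|}\,r(g,N\mu)!},$$ the limit being over sufficiently divisible $N$. This limit is equal to $(2\pi)^{-l/2}\prod_i\mu_i^{-1/2}\,P_g(\mu_1,\dots,\mu_l)$, where $P_g(x_1,\dots,x_l)=\sum_{k_1+\cdots+k_l=3g-3+l}\langle\tau_{k_1}\cdots\tau_{k_l}\rangle_g\prod_i x_i^{k_i}$, and $H_g(x_1,\dots,x_l)$ is defined for all positive real $x_i$ by this same formula. *)

(* Defs.v *)
From HB Require Import structures.
From mathcomp Require Import all_boot all_order all_algebra all_fingroup.
From mathcomp Require Import all_classical all_reals all_analysis.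

Set Implicit Arguments.
Unset Strict Implicit.
Unset Printing Implicit Defensive.

Import Order.TTheory GRing.Theory Num.Theory.
Import numFieldNormedType.Exports.

Local Open Scope ring_scope.

(* Hurwitz numbers.  A degree d cover of the projective line with simple
   branching over r fixed points of the affine line, and otherwise branched at
   most over infinity, is given up to isomorphism by its monodromy around the
   r points: r transpositions of the fibre 'I_d, up to simultaneous
   conjugation.  The monodromy at infinity is the inverse of their product, the
   cover is irreducible iff the monodromy is transitive, and the automorphisms
   of the cover are the permutations of the fibre commuting with it. *)
Section Hurwitz.

Definition monodromy (r d : nat) := {ffun 'I_r -> 'S_d}.

Definition monodromy_iso (r d : nat) : rel (monodromy r d) :=
  fun t u => [exists s : 'S_d, [forall i, u i == (t i ^ s)%g]].

Definition monodromy_aut (r d : nat) (t : monodromy r d) : {set 'S_d} :=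
  [set s : 'S_d | [forall i, t i ^ s == t i]%g]%SET.

Definition has_cycle_type (l d : nat) (mu : 'I_l -> nat) (s : 'S_d) : bool :=
  perm_eq [seq #|C| | C : {set 'I_d} <- enum (porbits s)]
          [seq mu i | i <- enum 'I_l].

Definition hurwitz_monodromy (r d l : nat) (mu : 'I_l -> nat) :
    {set monodromy r d} :=
  [set t : monodromy r d |
    [&& [forall i, exists x, exists y, (x != y) && (t i == tperm x y)],
        has_cycle_type mu (\prod_(i < r) t i)%g &
        [transitive <<[set t i | i : 'I_r]>>, on [set: 'I_d] | 'P]]]%SET.

(* 2g - 2 + |mu| + l; the subtraction does not truncate if l > 0 and mu > 0. *)
Definition hurwitz_r (g l : nat) (mu : 'I_l -> nat) : nat :=
  (2 * g + \sum_i mu i + l - 2)%N.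

Definition hurwitz (g l : nat) (mu : 'I_l -> nat) : rat :=
  let M := hurwitz_monodromy (hurwitz_r g mu) (\sum_i mu i)%N mu in
  \sum_(t in transversal
          (equivalence_partition (@monodromy_iso _ _) M) M)
    (#|monodromy_aut t|%:R)^-1.

End Hurwitz.

Local Open Scope classical_set_scope.

(* [A] stands for the even cohomology (or Chow) ring of the moduli stack of
   stable l-pointed curves of genus g with rational coefficients, [integ] for
   integration over its fundamental class and [psi i] for the first Chern class
   of the i-th cotangent line bundle. *)
Section PsiIntegrals.
Variables (g l : nat) (A : comAlgType rat) (integ : {scalar A}) (psi : 'I_l -> A).

Definition tau (k : 'I_l -> nat) : rat := integ (\prod_i psi i ^+ k i).

(* The dimension 3g - 3 + l; no truncation if 2g - 2 + l > 0. *)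
Definition moduli_dim : nat := (3 * g + l - 3)%N.

Variable R : realType.

(* The exponents k_i are bounded by their sum, so the sum is finite. *)
Definition P_poly (x : 'I_l -> R) : R :=
  \sum_(k : {ffun 'I_l -> 'I_moduli_dim.+1} | (\sum_i k i)%N == moduli_dim)
    ratr (tau (fun i => k i)) * \prod_i x i ^+ k i.

Definition hurwitz_ratio (N : nat) (m : 'I_l -> nat) : R :=
  ratr (hurwitz g m) /
  (N%:R `^ (3 * g%:R - 3 + l%:R / 2)
   * (expR (\sum_i m i)%N%:R * (hurwitz_r g m)`!%:R)).

(* [H] is the function H_g.  "N sufficiently divisible" means that N runs over
   the multiples k * D of any positive D making D * mu =: m integral.  The two
   clauses together determine [tau k] for all k of sum 3g - 3 + l. *)
Definition is_Hg (H : ('I_l -> R) -> R) : Prop :=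
  (forall (mu : 'I_l -> rat) (D : nat) (m : 'I_l -> nat),
     injective mu -> (forall i, 0 < mu i) -> (0 < D)%N ->
     (forall i, (m i)%:R = D%:R * mu i) ->
     hurwitz_ratio (k * D)%N (fun i => k * m i)%N @[k --> \oo]
       --> H (fun i => ratr (mu i))) /\
  (forall x : 'I_l -> R, (forall i, 0 < x i) ->
     H x = (2 * pi) `^ (- (l%:R / 2)) * (\prod_i x i `^ (- 2^-1)) * P_poly x).

End PsiIntegrals.

(* (2 k - 1)!!, with (-1)!! = 1 *)
Definition odd_dfact (k : nat) : nat := (\prod_(i < k) (2 * i + 1))%N.

(* Lebesgue measure on R^n, i.e. on n-tuples with the product sigma-algebra: the
   iterated product measure, transported along (x, t) |-> x :: t. *)
Section cons_measure.
Context d (T : measurableType d) (R : realType) (n : nat).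
Variables (m1 : {sigma_finite_measure set T -> \bar R})
  (m2 : {sigma_finite_measure set (n.-tuple T) -> \bar R}).

Definition pcons (p : T * n.-tuple T) : n.+1.-tuple T := [tuple of p.1 :: p.2].

Lemma measurable_pcons : measurable_fun [set: T * n.-tuple T] pcons.
Proof. exact: (@measurable_cons _ _ (T * n.-tuple T)%type T fst n snd). Qed.

Definition cons_measure : set (n.+1.-tuple T) -> \bar R :=
  pushforward (m1 \x m2)%E pcons.

Let cons_measure0 : cons_measure set0 = 0%E.
Proof. by rewrite /cons_measure /pushforward preimage_set0 measure0. Qed.

Let cons_measure_ge0 A : (0 <= cons_measure A)%E.
Proof. by rewrite /cons_measure /pushforward measure_ge0. Qed.

Let cons_measure_sigma_additive : semi_sigma_additive cons_measure.
Proof.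
move=> F mF tF mUF; rewrite /cons_measure /pushforward preimage_bigcup.
apply: measure_semi_sigma_additive.
- by move=> i; rewrite -[X in measurable X]setTI; exact: measurable_pcons.
- apply/trivIsetP => /= i j _ _ ij; rewrite -preimage_setI.
  by move/trivIsetP : tF => /(_ _ _ _ _ ij) ->//; rewrite preimage_set0.
- rewrite -preimage_bigcup -[X in measurable X]setTI.
  exact: measurable_pcons.
Qed.

HB.instance Definition _ := isMeasure.Build _ _ _ cons_measure
  cons_measure0 cons_measure_ge0 cons_measure_sigma_additive.

Let cons_measure_sigma_finite : sigma_finite setT cons_measure.
Proof.
have /sigma_finiteP[F [FT ndF Foo]] := sigma_finiteT m1.
have /sigma_finiteP[G [GT ndG Goo]] := sigma_finiteT m2.
pose tl (t : n.+1.-tuple T) : n.-tuple T := [tuple of behead t].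
exists (fun i => (fun t => tnth t ord0) @^-1` F i `&` tl @^-1` G i).
  apply/esym/seteqP; split=> // t _.
  have [i _ Fi] : (\bigcup_i F i) (tnth t ord0) by rewrite -FT.
  have [j _ Gj] : (\bigcup_i G i) (tl t) by rewrite -GT.
  exists (maxn i j) => //; split => /=.
  - by move: Fi; exact/subsetPset/ndF/leq_maxl.
  - by move: Gj; exact/subsetPset/ndG/leq_maxr.
move=> i; have [mF Fi] := Foo i; have [mG Gi] := Goo i; split.
  apply: measurableI; rewrite -[X in measurable X]setTI.
  - exact: (measurable_tnth ord0).
  - exact: measurable_behead.
rewrite /cons_measure /pushforward (_ : pcons @^-1` _ = F i `*` G i).
  by rewrite product_measure1E// lte_mul_pinfty// ge0_fin_numE.
have tlE p : tl (pcons p) = p.2 by exact: val_inj.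
by apply/seteqP; split=> -[a b] /=; rewrite tlE (tnth_nth a).
Qed.

HB.instance Definition _ := Measure_isSigmaFinite.Build _ _ _ cons_measure
  cons_measure_sigma_finite.

End cons_measure.

Fixpoint lebesgue_tuple (R : realType) (n : nat) :
    {sigma_finite_measure set (n.-tuple (measurableTypeR R)) -> \bar R} :=
  if n is n'.+1 then
    cons_measure (@lebesgue_measure R) (lebesgue_tuple R n')
  else \d_ ([tuple] : 0.-tuple (measurableTypeR R)).

Definition laplace (R : realType) (l : nat) (H : ('I_l -> R) -> R)
    (y : 'I_l -> R) : \bar R :=
  \int[lebesgue_tuple R l]_(x in [set x : l.-tuple R | forall i, 0 < tnth x i])
    (expR (- \sum_i y i * tnth x i) * H (tnth x))%:E.

(* Main.v *)
Require Import Defs.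
From mathcomp Require Import all_boot all_order all_algebra.
From mathcomp Require Import all_classical all_reals all_analysis.
From mathcomp Require Import measurable_realfun gauss_integral ring lra.

(* The Laplace transform factors over the variables by Tonelli, so it suffices
   to compute the integral of x^(k-1/2) e^(-yx) over x > 0.  The substitution
   u = sqrt(yx) turns it into the Gaussian moment of u^(2k) e^(-u^2) over u > 0,
   which integration by parts reduces to the Gauss integral; each step
   contributes a factor (2k+1)/2, whence (2k-1)!!. *)

Set Implicit Arguments.
Unset Strict Implicit.
Unset Printing Implicit Defensive.

Import Order.TTheory GRing.Theory Num.Theory.
Import numFieldNormedType.Exports.
Local Open Scope ring_scope.
Local Open Scope classical_set_scope.

(** * Even Gaussian moments on the half-line and the square-root substitution *)

Section gauss_moments.
Context {R : realType}.
Local Notation mu := (@lebesgue_measure R).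
Implicit Types (u : R) (k n : nat).

Definition gauss_monomial n u : R := u ^+ n * gauss_fun u.

Lemma continuous_gauss_monomial n : continuous (gauss_monomial n).
Proof.
move=> u; apply: (@cvgM _ _ _ _ (fun x => x ^+ n)).
  exact: exprn_continuous.
exact: continuous_gauss_fun.
Qed.

Lemma measurable_gauss_monomial n : measurable_fun setT (gauss_monomial n).
Proof.
by apply: continuous_measurable_fun; exact: continuous_gauss_monomial.
Qed.

Lemma gauss_monomial_even_ge0 k u : 0 <= gauss_monomial (2 * k) u.
Proof. by rewrite mulr_ge0 ?gauss_fun_ge0// exprM exprn_ge0// sqr_ge0. Qed.

(** Integration by parts in differential form: integrated with n = 2k, it links the moments of
    orders 2k and 2k+2 through a boundary term. *)
Lemma is_derive_gauss_monomial n u :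
  is_derive u 1 (gauss_monomial n.+1)
    (n.+1%:R * gauss_monomial n u - 2 * gauss_monomial n.+2 u).
Proof.
have dX m : is_derive u 1 (@GRing.exp R ^~ m.+1) (m.+1%:R * u ^+ m).
  apply: DeriveDef; first exact: exprn_derivable.
  by rewrite exp_derive /= [LHS]mulr1.
have dG : is_derive u 1 gauss_fun (- (2 * u * gauss_fun u)).
  have dN := is_deriveN (dX 1).
  apply: (is_derive_eq (is_derive1_comp (is_derive_expR _) dN)).
  by rewrite /gauss_fun /= expr1; ring.
apply: (is_derive_eq (is_deriveM (dX n) dG)).
rewrite -![_ *: _]/(_ * _) /gauss_monomial !exprS; ring.
Qed.

(** For u >= 1, e^(u^2) >= e^u >= u^(n+1)/(n+1)!, which bounds the function by (n+1)!/u. This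
    removes the boundary term at infinity. *)
Lemma gauss_monomial_cvg0 n : gauss_monomial n x @[x --> +oo] --> (0 : R).
Proof.
apply: (@squeeze_cvgr _ _ _ _ (fun=> 0) (fun u => n.+1`!%:R * u^-1)).
- near=> u.
  have u1 : 1 <= u by near: u; exact: nbhs_pinfty_ge.
  have u0 : 0 < u by rewrite (lt_le_trans _ u1).
  rewrite /gauss_monomial /gauss_fun mulr_ge0 ?expR_ge0 ?exprn_ge0 ?(ltW u0)//=.
  rewrite expRN ler_pdivrMr ?expR_gt0//.
  have : n.+1`!%:R * u^-1 * expR u <= n.+1`!%:R / u * expR (u ^+ 2).
    rewrite ler_wpM2l ?divr_ge0 ?(ltW u0)// ler_expR; nra.
  apply: le_trans.
  rewrite mulrAC ler_pdivlMr// -exprSr mulrC -ler_pdivrMr ?ltr0n ?fact_gt0//.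
  by apply: le_trans (expR_ge1Dxn n (ltW u0)); rewrite lerDr.
- exact: cvg_cst.
- rewrite -(mulr0 (n.+1`!%:R : R)); apply: cvgM; first exact: cvg_cst.
  apply/gtr0_cvgV0; last exact: cvg_id.
  by near=> u; near: u; exact: nbhs_pinfty_gt.
Unshelve. all: by end_near. Qed.

(** Truncation at n keeps the integrals finite, so the recursion in k can be proved on a segment
    before n tends to infinity. *)
Definition gauss_partial_moment k n : R :=
  (\int[mu]_(u in `[0, n%:R]) gauss_monomial (2 * k) u)%R.

Lemma integrable_gauss_monomial n (a b : R) :
  mu.-integrable `[a, b] (EFin \o gauss_monomial n).
Proof.
apply: continuous_compact_integrable; first exact: segment_compact.
exact/continuous_subspaceT/continuous_gauss_monomial.
Qed.

Lemma gauss_partial_momentS k n : (0 < n)%N ->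
  2 * gauss_partial_moment k.+1 n =
  (2 * k + 1)%:R * gauss_partial_moment k n - gauss_monomial (2 * k).+1 n%:R.
Proof.
(* With the boundary term isolated, the other side is the integral over [0, n] of the derivative of
   u^(2k+1) e^(-u^2), a function vanishing at 0. *)
move=> n0; apply/eqP; rewrite eq_sym subr_eq addrC -subr_eq; apply/eqP.
rewrite /gauss_partial_moment -!RintegralZl//;
  try exact: integrable_gauss_monomial.
rewrite -RintegralB//=; last 2 first.
  by apply: (integrableZl _ _ (integrable_gauss_monomial _ _ _)).
  by apply: (integrableZl _ _ (integrable_gauss_monomial _ _ _)).
rewrite /Rintegral.
rewrite (@continuous_FTC2 _ _ (gauss_monomial (2 * k).+1)).
- by rewrite /= [X in _ - X]/gauss_monomial expr0n mul0r subr0.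
- by rewrite ltr0n.
- apply/continuous_subspaceT => u; apply: cvgB.
    by apply: cvgM; [exact: cvg_cst|exact: continuous_gauss_monomial].
  by apply: cvgM; [exact: cvg_cst|exact: continuous_gauss_monomial].
- split.
  + by move=> u _; case: (is_derive_gauss_monomial (2 * k) u).
  + exact/cvg_at_right_filter/continuous_gauss_monomial.
  + exact/cvg_at_left_filter/continuous_gauss_monomial.
- move=> u _; rewrite derive1E addn1 mulnS.
  by case: (is_derive_gauss_monomial (2 * k) u).
Qed.

Lemma EFin_gauss_partial_moment k n :
  (gauss_partial_moment k n)%:E =
  (\int[mu]_(u in `[0%R, n%:R]) (gauss_monomial (2 * k) u)%:E)%E.
Proof.
rewrite fineK//; apply: integrable_fin_num => //.
exact: integrable_gauss_monomial.
Qed.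

Lemma gauss_partial_moment_cvg k :
  gauss_partial_moment k n @[n --> \oo] -->
    (odd_dfact k)%:R / 2 ^+ k * (Num.sqrt pi / 2).
Proof.
elim: k => [|k IH].
  rewrite /odd_dfact big_ord0 expr0 divr1 mul1r.
  have := @ge0_cvgn_integral R mu _ (@gauss_fun_ge0 R) measurable_gauss_fun.
  rewrite integral0y_gauss => /fine_cvg; apply: cvg_trans; apply: near_eq_cvg.
  near=> n; rewrite /gauss_partial_moment /Rintegral /=; congr fine.
  by apply: eq_integral => u _; rewrite /gauss_monomial expr0 mul1r.
have F0 : gauss_monomial (2 * k).+1 n%:R @[n --> \oo] --> (0 : R).
  exact: (cvg_comp _ _ cvgr_idn (gauss_monomial_cvg0 _)).
(* The target is put in the shape of the recursion divided by 2, with 0 as the limit of the boundary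
   term. *)
rewrite (_ : _ * (_ / 2) = ((2 * k + 1)%:R *
    ((odd_dfact k)%:R / 2 ^+ k * (Num.sqrt pi / 2)) - 0) / 2); last first.
  rewrite /odd_dfact big_ord_recr/= natrM subr0 exprS invfM; ring.
apply: cvg_trans (cvgM (cvgB (cvgM (cvg_cst _) IH) F0) (cvg_cst _)).
apply: near_eq_cvg; near=> n => /=.
  rewrite -[X in X * _]gauss_partial_momentS.
  by rewrite mulrAC mulfV ?mul1r// pnatr_eq0.
by near: n; exact: nbhs_infty_gt.
Unshelve. all: by end_near. Qed.

(** An even exponent makes the integrand nonnegative on the whole line, so the truncated moments
    converge to this integral; uniqueness of limits concludes. *)
Lemma integral0y_gauss_monomial k :
  (\int[mu]_(u in `[0%R, +oo[) (gauss_monomial (2 * k) u)%:E =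
  ((odd_dfact k)%:R / 2 ^+ k * (Num.sqrt pi / 2))%:E)%E.
Proof.
have := @ge0_cvgn_integral R mu _ (gauss_monomial_even_ge0 k)
  (measurable_gauss_monomial (2 * k)).
under eq_fun do rewrite -EFin_gauss_partial_moment.
move=> /(@cvg_unique _ _ _ _ _ _) ; apply => //.
by apply: cvg_EFin; [exact: nearW|exact: gauss_partial_moment_cvg].
Qed.

(** Monotone convergence in the domain: the half-lines [[b n, +oo[] increase to []0, +oo[]. It sends
    the cut-off to 0 on both sides of the substitution. *)
Lemma ge0_cvg_integral_itvcy (f : R -> R) (b : R^nat) :
  measurable_fun setT f -> (forall x, 0 < x -> 0 <= f x) ->
  (forall n, 0 < b n) -> nonincreasing_seq b -> b @ \oo --> (0 : R) ->
  (\int[mu]_(x in `[b n, +oo[) (f x)%:E @[n --> \oo] -->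
   \int[mu]_(x in `]0%R, +oo[) (f x)%:E)%E.
Proof.
move=> mf f0 b0 ndb cb.
have -> : `]0%R, +oo[%classic = \bigcup_n `[b n, +oo[%classic.
  apply/seteqP; split=> x /=; rewrite in_itv/= andbT.
    move=> x0; have [n _ /(_ n (leqnn n))] := cvgr_lt 0 cb _ x0.
    by move=> bnx; exists n => //=; rewrite in_itv/= andbT ltW.
  by case=> n _ /=; rewrite in_itv/= andbT; exact/lt_le_trans.
apply: ge0_nondecreasing_set_cvg_integral => //=.
- move=> m n mn; rewrite subsetEset => x /=; rewrite !in_itv/= !andbT.
  by apply: le_trans; exact: ndb.
- by move=> n; apply/measurable_EFinP; exact: measurable_funTS.
- move=> n x; rewrite in_itv/= andbT lee_fin => bx.
  by rewrite f0// (lt_le_trans (b0 n)).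
Qed.

(* The substitution theorem requires the derivative of the change of variables
   to converge at the left endpoint, and that of sqrt blows up at 0: hence the
   cut-off a > 0, sent to 0 afterwards. *)
Lemma gauss_integral_sqrt_substitution k (y a : R) : 0 < y -> 0 < a ->
  (\int[mu]_(u in `[(Num.sqrt y * Num.sqrt a)%R, +oo[)
     (gauss_monomial (2 * k) u)%:E =
   \int[mu]_(x in `[a, +oo[)
     ((y ^+ k * Num.sqrt y / 2) *
      (x `^ (- 2^-1) * x ^+ k * expR (- (y * x))))%:E)%E.
Proof.
move=> y0 a0.
(* For u = [F x], u^2 = yx and du = sqrt(y)/(2 sqrt(x)) dx, whence the constant y^k sqrt(y)/2 and
   the factor x^(-1/2). *)
pose F x : R := Num.sqrt y * Num.sqrt x.
pose F' x : R := Num.sqrt y * (2 * Num.sqrt x)^-1.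
have dF (x : R) : 0 < x -> is_derive x 1 F (F' x).
  move=> x0; have := is_deriveZ (Num.sqrt y) (is_derive1_sqrt x0).
  exact.
have F'E (x : R) : 0 < x -> F^`() x = F' x.
  by move=> /dF[_ <-]; rewrite derive1E.
have cF' (x : R) : 0 < x -> {for x, continuous F'}.
  move=> x0; apply: cvgM; first exact: cvg_cst.
  apply: cvgV; first by rewrite mulf_neq0// sqrtr_eq0 -ltNge.
  by apply: cvgM; [exact: cvg_cst|exact: sqrt_continuous].
(* The closed form of the derivative is established for positive arguments only, so continuity is
   transferred on a neighbourhood of x. *)
have nearF' (x : R) : 0 < x -> \forall z \near x, F' z = F^`() z.
  move=> x0; near=> z; rewrite F'E//; near: z; exact: lt_nbhsr.
have cderF (x : R) : 0 < x -> {for x, continuous F^`()}.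
  move=> x0; rewrite /prop_for /continuous_at F'E//.
  apply: cvg_trans (cF' _ x0); apply: near_eq_cvg; exact: nearF'.
have sqrty : Num.sqrt (x : R) @[x --> +oo] --> +oo.
  apply/cvgryPge => A; near=> x.
  by rewrite (le_trans (ler_norm A))// -sqrtr_sqr ler_wsqrtr//.
rewrite (@increasing_ge0_integration_by_substitutiony _ F
  (gauss_monomial (2 * k)) a).
- apply: eq_integral => x; rewrite inE/= in_itv/= andbT => ax.
  have x0 : 0 < x by rewrite (lt_le_trans a0).
  congr EFin; rewrite !fctE F'E// /gauss_monomial /gauss_fun /F /F'.
  have FF : (Num.sqrt y * Num.sqrt x) ^+ 2 = y * x.
    by rewrite exprMn !sqr_sqrtr// ltW.
  rewrite exprM FF powRN powR12_sqrt ?(ltW x0)// exprMn invfM.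
  by rewrite -!mulrA; congr (_ * _); ring.
- move=> x z; rewrite !in_itv/= !andbT => ax az xz.
  by rewrite /F ltr_pM2l ?sqrtr_gt0// ltr_sqrt// (lt_le_trans a0).
- by move=> x; rewrite in_itv/= andbT => /(lt_trans a0)/cderF.
- by apply/cvg_ex; exists (F^`() a); exact/cvg_at_right_filter/cderF.
- apply/cvg_ex; exists 0.
  have : F' (x : R) @[x --> +oo] --> Num.sqrt y * (2^-1 * 0).
    rewrite /F'; under eq_fun do rewrite invfM.
    apply: cvgM; first exact: cvg_cst.
    apply: cvgM; first exact: cvg_cst.
    apply/gtr0_cvgV0 => //.
    by near=> x; rewrite sqrtr_gt0; near: x; exact: nbhs_pinfty_gt.
  rewrite !mulr0; apply: cvg_trans; apply: near_eq_cvg.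
  by near=> x; rewrite F'E//; near: x; exact: nbhs_pinfty_gt.
- split.
    by move=> x; rewrite in_itv/= andbT => /(lt_trans a0)/dF[].
  apply: cvg_at_right_filter; apply: cvgM; first exact: cvg_cst.
  exact: sqrt_continuous.
- by apply: gt0_cvgMry => //; rewrite ?sqrtr_gt0.
- exact/continuous_subspaceT/continuous_gauss_monomial.
- by move=> x _; exact: gauss_monomial_even_ge0.
Unshelve. all: by end_near. Qed.

End gauss_moments.

(** * Integration of products of one-variable functions over R^n *)

Lemma measurable_tuple_prod (R : realType) n (f : 'I_n -> R -> R) :
  (forall i, measurable_fun setT (f i)) ->
  measurable_fun setT
    (fun x : n.-tuple (measurableTypeR R) => \prod_i f i (tnth x i)).
Proof.
move=> mf; apply: measurable_prod => i _.
by apply: measurableT_comp; [exact: mf|exact: measurable_tnth].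
Qed.

(** Induction on n: Tonelli splits off the first coordinate. In dimension 0 the measure is the Dirac
    mass at the empty tuple and both products are empty. *)
Lemma integral_lebesgue_tuple_prod (R : realType) n (f : 'I_n -> R -> R)
    (c : 'I_n -> R) :
  (forall i, measurable_fun setT (f i)) -> (forall i x, 0 <= f i x) ->
  (forall i, \int[lebesgue_measure]_x (f i x)%:E = (c i)%:E)%E ->
  (\int[lebesgue_tuple R n]_x (\prod_i f i (tnth x i))%:E = (\prod_i c i)%:E)%E.
Proof.
elim: n f c => [|n IH] f c mf f0 fc.
  under eq_integral do rewrite big_ord0.
  rewrite big_ord0 /= integral_dirac//= diracT mul1e//.
rewrite /= ge0_integral_pushforward//=; first last.
- move=> x _; rewrite lee_fin; exact: prodr_ge0.
- by apply/measurable_EFinP; exact: measurable_tuple_prod.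
- exact: measurable_pcons.
rewrite preimage_setT.
transitivity (\int[lebesgue_measure \x lebesgue_tuple R n]_p
   ((f ord0 p.1 * \prod_(i < n) f (lift ord0 i) (tnth p.2 i))%:E))%E.
  apply: eq_integral => -[a t] _ /=; rewrite big_ord_recl /pcons /=.
  congr ((_ * _)%:E).
  by apply: eq_bigr => i _; rewrite tnthS.
rewrite fubini_tonelli1//=; first last.
- by move=> x; rewrite lee_fin mulr_ge0// prodr_ge0.
- apply/measurable_EFinP; apply: measurable_funM.
    exact: (measurableT_comp (mf ord0) measurable_fst).
  exact: (measurableT_comp
    (measurable_tuple_prod (fun i => mf (lift ord0 i))) measurable_snd).
transitivity (\int[lebesgue_measure]_x
    ((\prod_(i < n) c (lift ord0 i))%:E * (f ord0 x)%:E))%E.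
  apply: eq_integral => x _; rewrite /fubini_F /=.
  under eq_integral do rewrite EFinM.
  rewrite ge0_integralZl_EFin//.
  - rewrite (IH (fun i => f (lift ord0 i)) (fun i => c (lift ord0 i)))//.
    by rewrite muleC.
  - by move=> t _; rewrite lee_fin prodr_ge0.
  - apply/measurable_EFinP.
    exact: (measurable_tuple_prod (f := fun i => f (lift ord0 i))).
rewrite ge0_integralZl_EFin//.
- by rewrite fc big_ord_recl -EFinM mulrC.
- by move=> t _; rewrite lee_fin.
- by apply/measurable_EFinP; exact: mf.
- apply: prodr_ge0 => i _; rewrite -lee_fin -fc integral_ge0// => x _.
  by rewrite lee_fin.
Qed.

(** * One-variable Laplace transforms of x^(k-1/2) *)

Section laplace_monomial.
Context {R : realType}.
Implicit Types (k : nat) (y x : R).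

(** Each variable carries one of the l factors of (2 pi)^(-l/2). Extension by 0 turns the integral
    over the positive orthant into one over all of R^l. *)
Definition laplace_monomial k y x : R :=
  if 0 < x then
    (2 * pi) `^ (- 2^-1) * (x `^ (- 2^-1) * x ^+ k * expR (- (y * x)))
  else 0.

Lemma measurable_half_power_expR k y :
  measurable_fun setT (fun x : R => x `^ (- 2^-1) * x ^+ k * expR (- (y * x))).
Proof.
apply: measurable_funM.
  by apply: measurable_funM; [exact: measurable_powR|exact: exprn_measurable].
by do 2 apply: measurableT_comp => //; exact: mulrl_measurable.
Qed.

Lemma measurable_laplace_monomial k y :
  measurable_fun setT (laplace_monomial k y).
Proof.
apply: measurable_fun_ifT => //.
  exact: measurable_fun_ltr.
by apply: measurable_funM => //; exact: measurable_half_power_expR.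
Qed.

Lemma laplace_monomial_ge0 k y x : 0 <= laplace_monomial k y x.
Proof.
rewrite /laplace_monomial; case: ltP => // x0.
by rewrite !mulr_ge0 ?powR_ge0 ?exprn_ge0 ?expR_ge0// ltW.
Qed.

Lemma integral_half_power_expR k y : 0 < y ->
  (\int[lebesgue_measure]_(x in `]0%R, +oo[)
     (x `^ (- 2^-1) * x ^+ k * expR (- (y * x)))%:E =
  ((odd_dfact k)%:R * Num.sqrt pi / (2 ^+ k * (y ^+ k * Num.sqrt y)))%:E)%E.
Proof.
move=> y0.
(* The constant produced by the substitution u = sqrt(yx). *)
pose c := y ^+ k * Num.sqrt y / 2.
have c0 : 0 < c by rewrite !mulr_gt0 ?exprn_gt0 ?sqrtr_gt0.
set f := fun x : R => x `^ (- 2^-1) * x ^+ k * expR (- (y * x)).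
have f0 x : 0 < x -> 0 <= f x.
  by move=> x0; rewrite !mulr_ge0 ?powR_ge0 ?exprn_ge0 ?expR_ge0// ltW.
pose b n : R := n.+1%:R^-1.
have b0 n : 0 < b n by rewrite invr_gt0.
have ndb : nonincreasing_seq b.
  by move=> m n mn; rewrite lef_pV2 ?posrE// ler_nat ltnS.
have cb : b @ \oo --> (0 : R) by exact: cvg_harmonic.
have lim_f :=
  ge0_cvg_integral_itvcy (measurable_half_power_expR k y) f0 b0 ndb cb.
pose s n : R := Num.sqrt y * Num.sqrt (b n).
have lim_g : (\int[lebesgue_measure]_(u in `[s n, +oo[)
    (gauss_monomial (2 * k) u)%:E @[n --> \oo] -->
    \int[lebesgue_measure]_(u in `]0%R, +oo[) (gauss_monomial (2 * k) u)%:E)%E.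
  apply: ge0_cvg_integral_itvcy.
  - exact: measurable_gauss_monomial.
  - by move=> x _; exact: gauss_monomial_even_ge0.
  - by move=> n; rewrite mulr_gt0 ?sqrtr_gt0.
  - by move=> m n mn; rewrite ler_pM2l ?sqrtr_gt0// ler_wsqrtr// ndb.
  - rewrite -[X in _ --> X](mulr0 (Num.sqrt y)) -[X in _ * X](@sqrtr0 R).
    apply: cvgM; first exact: cvg_cst.
    exact: (cvg_comp _ _ cb (@sqrt_continuous R 0)).
have gf n : (\int[lebesgue_measure]_(u in `[s n, +oo[)
    (gauss_monomial (2 * k) u)%:E =
    c%:E * \int[lebesgue_measure]_(x in `[b n, +oo[) (f x)%:E)%E.
  rewrite gauss_integral_sqrt_substitution//.
  under eq_integral do rewrite EFinM.
  rewrite ge0_integralZl_EFin//.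
  - move=> x; rewrite /= in_itv/= andbT lee_fin => bx.
    by rewrite f0// (lt_le_trans (b0 n)).
  - apply/measurable_EFinP/measurable_funTS; exact: measurable_half_power_expR.
  - exact: ltW.
have lim_cf := cvgeZl (isT : c%:E \is a fin_num) lim_f.
have : (c%:E * \int[lebesgue_measure]_(x in `]0%R, +oo[) (f x)%:E =
   ((odd_dfact k)%:R / 2 ^+ k * (Num.sqrt pi / 2))%:E)%E.
  (* The moment was computed on the closed half-line, while the limit lives on the open one; the
     endpoint 0 is a null set. *)
  rewrite -integral0y_gauss_monomial -integral_itv_obnd_cbnd; last first.
    apply/measurable_EFinP/measurable_funTS; exact: measurable_gauss_monomial.
  apply: (cvg_unique _ lim_cf) => //; apply: cvg_trans lim_g.
  by apply: near_eq_cvg; near=> n; rewrite gf.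
move=> /(congr1 (fun z => c^-1%:E * z)%E).
rewrite muleA -EFinM mulVf ?gt_eqF// mul1e => ->; congr EFin.
rewrite /c; field.
by rewrite !expf_neq0 ?gt_eqF ?sqrtr_gt0.
Unshelve. all: by end_near. Qed.

(** The factor sqrt(pi) cancels against (2 pi)^(-1/2), and the remaining powers form s^(2k+1) =
    (2y)^k sqrt(2y) for s = sqrt(2y). *)
Lemma integral_laplace_monomial k y : 0 < y ->
  (\int[lebesgue_measure]_x (laplace_monomial k y x)%:E =
  ((odd_dfact k)%:R / Num.sqrt (2 * y) ^+ (2 * k + 1))%:E)%E.
Proof.
move=> y0.
transitivity (\int[lebesgue_measure]_(x in `]0%R, +oo[)
    (((2 * pi) `^ (- 2^-1))%:E *
     (x `^ (- 2^-1) * x ^+ k * expR (- (y * x)))%:E))%E.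
  rewrite [RHS]integral_mkcond; apply: eq_integral => x _.
  by rewrite patchE /laplace_monomial mem_setE in_itv/= andbT -EFinM; case: ifP.
rewrite ge0_integralZl_EFin//.
- rewrite integral_half_power_expR// -EFinM; congr EFin.
  rewrite exprD expr1 exprM sqr_sqrtr ?mulr_ge0 ?(ltW y0)//.
  rewrite powRN powR12_sqrt ?mulr_ge0 ?pi_ge0// !sqrtrM//.
  have spi : Num.sqrt pi != 0 :> R by rewrite sqrtr_eq0 -ltNge pi_gt0.
  have s2 : Num.sqrt 2 != 0 :> R by rewrite sqrtr_eq0 -ltNge.
  have sy : Num.sqrt y != 0 by rewrite sqrtr_eq0 -ltNge.
  have yk : y ^+ k != 0 by rewrite expf_neq0// gt_eqF.
  have tk : 2 ^+ k != 0 :> R by rewrite expf_neq0.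
  rewrite exprMn; field.
  by rewrite ?spi ?s2 ?sy ?yk ?tk.
- move=> x; rewrite /= in_itv/= andbT lee_fin => x0.
  by rewrite !mulr_ge0 ?powR_ge0 ?exprn_ge0 ?expR_ge0// ltW.
- apply/measurable_EFinP/measurable_funTS; exact: measurable_half_power_expR.
- exact: powR_ge0.
Qed.

End laplace_monomial.

(** * Assembly over the monomials of P_g *)

Theorem theorem3 (R : realType) (g l : nat)
    (A : comAlgType rat) (integ : {scalar A}) (psi : 'I_l -> A)
    (Hg : ('I_l -> R) -> R) (y : 'I_l -> R) :
  (1 <= l)%N -> (2 < 2 * g + l)%N ->
  is_Hg g integ psi Hg ->
  (forall i, 0 < y i) ->
  laplace Hg y =
  (\sum_(k : {ffun 'I_l -> 'I_(moduli_dim g l).+1}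
         | (\sum_i k i)%N == moduli_dim g l)
     ratr (tau integ psi (fun i => k i)) *
     \prod_i ((odd_dfact (k i))%:R / Num.sqrt (2 * y i) ^+ (2 * k i + 1)))%:E.
Proof.
move=> _ _ [_ HgE] y0.
pose K := {ffun 'I_l -> 'I_(moduli_dim g l).+1}.
pose t (k : K) : R := ratr (tau integ psi (fun i => k i)).
pose Phi (k : K) (x : l.-tuple (measurableTypeR R)) : R :=
  \prod_i laplace_monomial (k i) (y i) (tnth x i).
have Phi_int (k : K) : (\int[lebesgue_tuple R l]_x (Phi k x)%:E =
    (\prod_i ((odd_dfact (k i))%:R /
              Num.sqrt (2 * y i) ^+ (2 * k i + 1)))%:E)%E.
  apply: (integral_lebesgue_tuple_prod
    (f := fun i => laplace_monomial (k i) (y i))) => i.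
  - exact: measurable_laplace_monomial.
  - by move=> x; exact: laplace_monomial_ge0.
  - exact: integral_laplace_monomial.
(* The coefficients [t k] may have any sign, so exchanging sum and integral rests on integrability;
   each [Phi k] is nonnegative with finite integral. *)
have Phi_integrable (k : K) :
    (lebesgue_tuple R l).-integrable setT (EFin \o Phi k).
  apply/integrableP; split.
    apply/measurable_EFinP; apply: (measurable_tuple_prod
      (f := fun i => laplace_monomial (k i) (y i))) => i.
    exact: measurable_laplace_monomial.
  under eq_integral => x _.
    rewrite /= ger0_norm; last first.
      by apply: prodr_ge0 => i _; exact: laplace_monomial_ge0.
    over.
  by rewrite Phi_int ltry.
transitivity (\int[lebesgue_tuple R l]_x
    \sum_(k : K | (\sum_i k i)%N == moduli_dim g l)
      ((t k)%:E * (Phi k x)%:E))%E.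
  rewrite /laplace integral_mkcond; apply: eq_integral => x _.
  rewrite patchE; case: ifPn => [/set_mem x0|/negP x0].
    under [in RHS]eq_bigr do rewrite -EFinM.
    rewrite sumEFin HgE// /P_poly; congr EFin.
    rewrite !mulr_sumr; apply: eq_bigr => k _.
    rewrite /Phi.
    under [in RHS]eq_bigr => i _ do rewrite /laplace_monomial x0.
    (* The l copies of (2 pi)^(-1/2) recombine into (2 pi)^(-l/2), and the exponentials into that of
       -y.x. *)
    rewrite !big_split/= prodr_const card_ord -powR_mulrn ?powR_ge0//.
    rewrite -powRrM mulNr [2^-1 * _]mulrC -sumrN expR_sum /t; ring.
  (* Off the orthant some coordinate is not positive, and its factor makes every [Phi k] vanish. *)
  have [i xi] : exists i, ~ (0 < tnth x i).
    by apply/existsNP => x0'; apply/x0/mem_set.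
  rewrite big1// => k _; rewrite /Phi (bigD1 i)//= /laplace_monomial.
  by move/negP/negbTE : xi => ->; rewrite mul0r mule0.
rewrite integral_sum//; last first.
  by move=> k; apply: integrableZl (Phi_integrable k).
rewrite -sumEFin; apply: eq_bigr => k _.
by rewrite (integralZl _ (Phi_integrable k))// Phi_int -EFinM.
Qed.
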